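(* For $k\in[N]$, let $P^{(k)}$ be the matrix indexed by $St\times St$ with entries $$P^{(k)}_{\eta,\eta'}=\mathbb{P}(\mathcal{RS}(\eta+\delta^k)=\eta').$$ Then for all $k,\ell\in[N]$, $P^{(k)}P^{(\ell)}=P^{(\ell)}P^{(k)}$.
   Context: Let $N$ be a nonnegative integer and $[N]=\{1,\ldots,N\}$ the set of sites. A sandpile configuration is a vector $\eta=(\eta_k)_{k\in[N]}$ of positive integers. For $v\in[N]$, let $$\mathcal{S}_v=\{\nu\in\mathbb{Z}^{[N]} : \nu_v<0,\ \nu_w\ge 0 \text{ for } w\ne v,\ \sum_{i=1}^N\nu_i\le 0\}$$ be the set of possible topplings of $v$; performing the toppling $\nu$ replaces $\eta$ by $\eta+\nu$. For each $v$, $\lambda_v$ is a probability distribution with finite support on $\mathcal{S}_v$, and the threshold of $v$ is $M_v=\max\{-\nu_v : \nu\in\mathcal{S}_v,\ \lambda_v(\nu)\neq 0\}$. In a configuration $\eta$, site $v$ is stable if $\eta_v\le M_v$ and unstable otherwise; $\eta$ is stable if all its sites are stable. The set of stable configurations is $St=[M_1]\times\cdots\times[M_N]$. For $v\in[N]$, $\delta^v$ denotes the vector with a $1$ in position $v$ and $0$ elsewhere. Standing assumption: for every nonempty subset $H\subseteq[N]$ there exists $\ell\in H$ such that $\lambda_\ell(\{\nu\in\mathcal{S}_\ell : \sum_{k\in H}\nu_k<0\})>0$. Random stabilization: given a configuration $\eta$, the random stable configuration $\mathcal{RS}(\eta)$ is obtained as follows: while the current configuration $\eta$ is not stable, pick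 an arbitrary unstable site $v$, draw $D_v\in\mathcal{S}_v$ with law $\lambda_v$ independently from the past, and replace $\eta$ by $\eta+D_v$; when the configuration is stable, return it. Under the standing assumption this terminates almost surely and the law of $\mathcal{RS}(\eta)$ does not depend on which unstable site is picked at each step (for definiteness one may always pick the smallest unstable site). *)

(* Defs.v *)
From mathcomp Require Import all_boot all_order all_algebra finmap.
From mathcomp Require Import all_classical all_reals all_analysis.

Set Implicit Arguments.
Unset Strict Implicit.
Unset Printing Implicit Defensive.

Import Order.TTheory GRing.Theory Num.Theory.
Local Open Scope classical_set_scope.
Local Open Scope ring_scope.

(* Z^[N], with its pointwise additive group structure. The site set
   [N] = {1, ..., N} is represented by 'I_N = {0, ..., N-1}. *)
Notation zvec N := {ffun 'I_N -> int}.

Definition delta (N : nat) (k : 'I_N) : zvec N := [ffun v => (v == k)%:Z].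

Definition toppling (N : nat) (v : 'I_N) (nu : zvec N) : Prop :=
  [/\ nu v < 0, forall w, w != v -> 0 <= nu w & \sum_i nu i <= 0].

Notation zlaw R N := {fsfun zvec N -> R with 0}.

Definition toppling_law (R : realType) (N : nat) (v : 'I_N) (p : zlaw R N) :
    Prop :=
  [/\ forall nu, nu \in finsupp p -> toppling v nu,
      forall nu, 0 <= p nu
    & \sum_(nu <- finsupp p) p nu = 1].

Definition dissipative (R : realType) (N : nat) (lam : 'I_N -> zlaw R N) :
    Prop :=
  forall H : {set 'I_N}, H != finset.set0 ->
    exists2 l, l \in H &
      0 < \sum_(nu <- finsupp (lam l) | \sum_(k in H) nu k < 0) lam l nu.

(* On the support of a toppling law of v one has nu v < 0, so that
   `|nu v| = - nu v; the threshold is kept in nat to index ordinals. *)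
Definition threshold (R : realType) (N : nat) (lam : 'I_N -> zlaw R N)
    (v : 'I_N) : nat :=
  (\max_(nu <- finsupp (lam v)) `|- nu v|)%N.

Definition unstable (R : realType) (N : nat) (lam : 'I_N -> zlaw R N)
    (eta : zvec N) (v : 'I_N) : bool :=
  (threshold lam v)%:Z < eta v.

Definition stable (R : realType) (N : nat) (lam : 'I_N -> zlaw R N)
    (eta : zvec N) : bool :=
  [forall v, ~~ unstable lam eta v].

(* The finite product [M_1] x ... x [M_N]; as 'I_m is {0, ..., m-1} while
   [m] is {1, ..., m}, the coordinate s v stands for the height (s v) + 1. *)
Notation St lam := {dffun forall v, 'I_(threshold lam v)}.

Definition config_of_St (R : realType) (N : nat) (lam : 'I_N -> zlaw R N)
    (s : St lam) : zvec N :=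
  [ffun v => (s v).+1%:Z].

(* A rule choosing the site to topple may look at the whole history of the
   run, listed from the current configuration back to the initial one; it is
   legal if it chooses an unstable site whenever there is one. *)
Definition legal_rule (R : realType) (N : nat) (lam : 'I_N -> zlaw R N)
    (pick : seq (zvec N) -> 'I_N) : Prop :=
  forall eta past, ~~ stable lam eta -> unstable lam eta (pick (eta :: past)).

(* D n v is the toppling drawn at step n in case site v is picked there.
   Z^[N] is countable and carries the discrete sigma-algebra. *)
Definition independent_draws (R : realType) (d : measure_display)
    (Omega : measurableType d) (Pr : probability Omega R)
    (N : nat) (lam : 'I_N -> zlaw R N)
    (D : nat -> 'I_N -> Omega -> zvec N) : Prop :=
  [/\ forall n v (B : set (zvec N)), measurable (D n v @^-1` B),
      forall n v nu, Pr (D n v @^-1` [set nu]) = (lam v nu)%:E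
    & forall (J : {fset nat * 'I_N}) (B : nat * 'I_N -> set (zvec N)),
        Pr (\bigcap_(j in [set` J]) (D j.1 j.2 @^-1` B j)) =
        (\prod_(j <- J) Pr (D j.1 j.2 @^-1` B j))%E].

(* The current configuration after n topplings started from eta, together
   with the earlier configurations (most recent first). Only the part of the
   run up to the first stable configuration is used, see RS. *)
Fixpoint run (N : nat) (pick : seq (zvec N) -> 'I_N)
    (D : nat -> 'I_N -> zvec N) (eta : zvec N) (n : nat) :
    zvec N * seq (zvec N) :=
  if n is m.+1 then
    let: (cur, past) := run pick D eta m in
    (cur + D m (pick (cur :: past)), cur :: past)
  else (eta, [::]).

(* The first stable configuration met by the run, and None on the event
   that the run never stabilizes. *)
Definition RS (R : realType) (N : nat) (lam : 'I_N -> zlaw R N) (Omega : Type)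
    (pick : seq (zvec N) -> 'I_N) (D : nat -> 'I_N -> Omega -> zvec N)
    (eta : zvec N) (w : Omega) : option (zvec N) :=
  let X n := (run pick (fun m v => D m v w) eta n).1 in
  if pselect (exists n, stable lam (X n)) is left ex
  then Some (X (ex_minn ex)) else None.

(* Rows and columns follow the enumeration of the finite type St lam. *)
Definition Pmx (R : realType) (d : measure_display) (Omega : measurableType d)
    (Pr : probability Omega R) (N : nat) (lam : 'I_N -> zlaw R N)
    (pick : seq (zvec N) -> 'I_N) (D : nat -> 'I_N -> Omega -> zvec N)
    (k : 'I_N) : 'M[R]_#|{: St lam}| :=
  \matrix_(i, j) fine (Pr [set w |
    RS lam pick D (config_of_St (enum_val i) + delta k) w
    = Some (config_of_St (enum_val j))]).

(* Main.v *)
Require Import Defs.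
From mathcomp Require Import all_boot all_order all_algebra finmap.
From mathcomp Require Import all_classical all_reals all_analysis.

(** Write T_v f(eta) = E f(eta + nu), nu drawn from lambda_v ([avg]), and let
    r_n(sigma, eta) be the probability that stabilizing eta, under a fixed way
    of choosing unstable sites, takes exactly n topplings and ends in the
    stable sigma ([reach]).

    Abelian property ([reach_topple]): r_(n+1)(sigma, .) = T_w r_n(sigma, .) at
    every configuration in which w is unstable, whatever the rule would have
    chosen there. Indeed the T_v commute, and toppling v leaves every other
    unstable site unstable, so that two topplings at distinct unstable sites
    can be exchanged; induct on n.

    Two consequences. First, adding chi >= 0 to xi > 0 keeps the unstable sites
    of xi unstable, so xi + chi can be stabilized by first performing the
    topplings that stabilize xi while chi waits, and then the remaining ones.
    This gives the convolution [reach_add]: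
      r_n(sigma, xi + chi)
        = sum_(m <= n) sum_(s in St) r_m(s, xi) r_(n-m)(sigma, s + chi).
    Second, P(RS(eta) = sigma) = sum_n r_n(sigma, eta) for every legal rule,
    even a history-dependent one ([Pr_RS]): condition on one toppling at a
    time, the next draw being independent of the past.

    Summing the convolution over n is a Cauchy product of nonnegative series,
    so the entry (eta, sigma) of P^(k) P^(l) is
    sum_n r_n(sigma, eta + delta^k + delta^l) ([Pmx_mulE]), which is symmetric
    in k and l. Counting topplings exactly makes every identity before that
    summation a finite one, proved by induction on the number of topplings. *)

Set Implicit Arguments.
Unset Strict Implicit.
Unset Printing Implicit Defensive.

Import Order.TTheory GRing.Theory Num.Theory.
Local Open Scope ring_scope.

(** * Two facts on series and probabilities *)

(** Nonnegativity allows the exchange of the sums over n and m of the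
    u_m v_(n-m), extended by 0 to m > n; the inner series are then shifts
    of v. *)
Lemma nneseries_cauchy_product (R : realType) (u v : nat -> R) :
  (forall n, 0 <= u n) -> (forall n, 0 <= v n) ->
  (\sum_(n <oo) (v n)%:E \is a fin_num)%E ->
  (\sum_(n <oo) (\sum_(m < n.+1) u m * v (n - m)%N)%:E =
  (\sum_(n <oo) (u n)%:E) * (\sum_(n <oo) (v n)%:E))%E.
Proof.
move=> u_ge0 v_ge0 v_fin.
pose f n m := if (m <= n)%N then (u m * v (n - m)%N)%:E else 0%E.
have f_ge0 n m : (0 <= f n m)%E.
  by rewrite /f; case: ifP => // _; rewrite lee_fin mulr_ge0.
transitivity (\sum_(n <oo) \sum_(m <oo) f n m)%E.
  apply: eq_eseriesr => n _; rewrite (nneseries_split 0 n.+1)//.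
  rewrite [X in (_ + X)%E]eseries0 ?adde0; last first.
    by move=> m; rewrite add0n /f ltnNge => /negbTE ->.
  rewrite add0n big_mkord -sumEFin; apply: eq_bigr => m _.
  by rewrite /f -ltnS ltn_ord.
rewrite nneseries_interchange//.
have [V vV] : exists V, (\sum_(n <oo) (v n)%:E = V%:E)%E.
  by exists (fine (\sum_(n <oo) (v n)%:E)%E); rewrite fineK.
rewrite vV muleC -nneseriesZl//; last by move=> n _; rewrite lee_fin.
apply: eq_eseriesr => m _; rewrite muleC -vV -nneseriesZl; last first.
  by move=> n _; rewrite lee_fin.
rewrite (nneseries_split 0 m)// big1_seq ?add0e ?add0n; last first.
  by move=> n; rewrite mem_index_iota /= /f ltnNge => /negbTE ->.
rewrite -nneseries_addn//; apply: eq_eseriesr => n _.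
by rewrite /f leq_addl addnK EFinM.
Qed.

(** Total probability over the values of a variable that lies almost surely
    in a finite set, although its codomain may be infinite. *)
Lemma measure_split_fin (d : measure_display) (Omega : measurableType d)
    (R : realType) (Pr : probability Omega R) (T : choiceType)
    (X : Omega -> T) (F : {fset T}) (A : set Omega) :
  measurable A ->
  (forall x, measurable (X @^-1` [set x])%classic) ->
  (\sum_(x <- F) Pr (X @^-1` [set x])%classic = 1)%E ->
  Pr A = (\sum_(x <- F) Pr (A `&` X @^-1` [set x])%classic)%E.
Proof.
move=> mA mX sum1.
have pre_triv B : trivIset [set` F] (fun x => B `&` X @^-1` [set x])%classic.
  exact: trivIset_preimage1_in.
have PrU B : measurable B -> Pr (B `&` X @^-1` [set` F])%classic =
    (\sum_(x <- F) Pr (B `&` X @^-1` [set x])%classic)%E.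
  move=> mB; have -> : (B `&` X @^-1` [set` F] =
      \bigcup_(x in [set` F]) (B `&` X @^-1` [set x]))%classic.
    apply/seteqP; split=> [w [Bw Fw]|w [x Fx [Bw /= Xw]]]; last first.
      by split; rewrite //= Xw.
    by exists (X w).
  rewrite measure_fin_bigcup//; last by move=> x _; exact: measurableI.
  by rewrite fsbig_finite//= set_fsetK.
have mF : measurable (X @^-1` [set` F])%classic.
  have -> : (X @^-1` [set` F] = \bigcup_(x in [set` F]) (X @^-1` [set x]))%classic.
    by apply/seteqP; split=> [w Fw|w [x Fx /= Xw]]; [exists (X w)|rewrite /= Xw].
  exact: fin_bigcup_measurable.
rewrite -PrU// (measureDI _ mA mF) [X in (X + _)%E](_ : _ = 0%E) ?add0e//.
apply/eqP; rewrite eq_le measure_ge0 andbT.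
rewrite (@le_trans _ _ (Pr (~` (X @^-1` [set` F]))%classic))//.
  by apply: le_measure; rewrite ?inE; [exact: measurableD|exact: measurableC|exact: subIsetr].
rewrite probability_setC// -(setTI (X @^-1` _))%classic PrU//.
under eq_bigr do rewrite setTI.
by rewrite sum1 subee.
Qed.

(** * The abelian property *)

Section Sandpile.
Variables (R : realType) (N : nat) (lam : 'I_N -> zlaw R N).
Hypothesis lamP : forall v, toppling_law v (lam v).

Definition avg (v : 'I_N) (f : zvec N -> R) (eta : zvec N) : R :=
  \sum_(nu <- finsupp (lam v)) lam v nu * f (eta + nu).

Lemma eq_avg v f g eta :
  (forall nu, nu \in finsupp (lam v) -> f (eta + nu) = g (eta + nu)) ->
  avg v f eta = avg v g eta.
Proof. by move=> fg; apply: eq_big_seq => nu nu_supp; rewrite fg. Qed.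

Lemma avg_comm v w f eta : avg v (avg w f) eta = avg w (avg v f) eta.
Proof.
rewrite /avg; under eq_bigr do rewrite mulr_sumr.
rewrite exchange_big; apply: eq_bigr => nu _.
rewrite mulr_sumr; apply: eq_bigr => mu _.
by rewrite mulrCA addrAC.
Qed.

(** Only a toppling of w itself can lower the height of w. *)
Lemma unstable_topple v w nu eta :
  nu \in finsupp (lam v) -> w != v -> unstable lam eta w ->
  unstable lam (eta + nu) w.
Proof.
have [supp_topp _ _] := lamP v.
move=> /supp_topp[_ nu_ge0 _] w_neq_v; rewrite /unstable ffunE => eta_gt.
by rewrite (lt_le_trans eta_gt)// lerDl nu_ge0.
Qed.

Lemma unstableN_stable eta v : unstable lam eta v -> stable lam eta = false.
Proof. by move=> eta_v; apply/negbTE/forallPn; exists v; rewrite negbK. Qed.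

(** The law of the pair (number of topplings, final configuration) when a
    site depending only on the current configuration is toppled. By
    [reach_topple] it does not depend on that choice. *)
Fixpoint reach (n : nat) (sigma eta : zvec N) : R :=
  if n is m.+1 then
    if [pick v | unstable lam eta v] is Some v then avg v (reach m sigma) eta
    else 0
  else (eta == sigma)%:R.

Lemma reach_ge0 n sigma eta : 0 <= reach n sigma eta.
Proof.
elim: n eta => [|n IHn] eta /=; first exact: ler0n.
case: pickP => // v _; apply: sumr_ge0 => nu _.
by rewrite mulr_ge0//; have [_ ->] := lamP v.
Qed.

Lemma reachS_stable n sigma eta : stable lam eta -> reach n.+1 sigma eta = 0.
Proof. by move=> /forallP st /=; case: pickP => // v; rewrite (negbTE (st v)). Qed.

Lemma reach0_unstable sigma eta v :
  stable lam sigma -> unstable lam eta v -> reach 0 sigma eta = 0.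
Proof.
move=> st eta_v /=; case: eqP => // eta_sigma.
by move: st; rewrite -eta_sigma (unstableN_stable eta_v).
Qed.

Lemma avg0 v f eta :
  (forall nu, nu \in finsupp (lam v) -> f (eta + nu) = 0) -> avg v f eta = 0.
Proof. by move=> f0; rewrite /avg big_seq big1// => nu /f0 ->; rewrite mulr0. Qed.

(** If the rule topples v <> w, then w is still unstable afterwards and, by
    induction, may be toppled second: r_(n+2) = T_v T_w r_n. Exchanging the
    commuting averages, and using that v is still unstable after toppling w,
    gives T_w T_v r_n = T_w r_(n+1). For n = 0 both sides vanish, since one
    toppling cannot cure two unstable sites. *)
Lemma reach_topple n sigma eta w :
  stable lam sigma -> unstable lam eta w ->
  reach n.+1 sigma eta = avg w (reach n sigma) eta.
Proof.
move=> st; elim: n eta w => [|n IHn] eta w eta_w; rewrite [LHS]/=.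
all: case: pickP => [v eta_v|/(_ w)]; last by rewrite eta_w.
all: have [-> //|w_neq_v] := eqVneq w v.
  rewrite !avg0// => nu nu_supp; apply: reach0_unstable => //.
    by apply: unstable_topple nu_supp _ eta_v; rewrite eq_sym.
  exact: unstable_topple nu_supp w_neq_v eta_w.
have -> : avg v (reach n.+1 sigma) eta = avg v (avg w (reach n sigma)) eta.
  by apply: eq_avg => nu nu_supp; apply: IHn; exact: unstable_topple nu_supp _ eta_w.
rewrite avg_comm; apply: eq_avg => nu nu_supp; apply/esym/IHn.
by apply: unstable_topple nu_supp _ eta_v; rewrite eq_sym.
Qed.

Lemma threshold_ge v nu :
  nu \in finsupp (lam v) -> - (threshold lam v)%:Z <= nu v.
Proof.
move=> nu_supp; have [supp_topp _ _] := lamP v.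
have [nu_lt0 _ _] := supp_topp _ nu_supp.
have : (`|- nu v| <= threshold lam v)%N.
  exact: (@leq_bigmax_seq _ _ xpredT (fun nu : zvec N => `|- nu v|%N)).
have nuN_ge0 : 0 <= - nu v by rewrite oppr_ge0 ltW.
by rewrite -lez_nat gez0_abs// lerNl.
Qed.

(** Positivity of the heights is what makes the finite set St contain every
    stable configuration that a stabilization can end in. *)
Lemma topple_positive (eta : zvec N) v nu :
  (forall w, 0 < eta w) -> unstable lam eta v -> nu \in finsupp (lam v) ->
  forall w, 0 < (eta + nu) w.
Proof.
move=> eta_gt0 eta_v nu_supp w; rewrite ffunE.
have [->|w_neq_v] := eqVneq w v.
  by rewrite -(opprK (nu v)) subr_gt0 (le_lt_trans _ eta_v)// lerNl threshold_ge.
have [supp_topp _ _] := lamP v; have [_ nu_ge0 _] := supp_topp _ nu_supp.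
by rewrite ltr_wpDr// nu_ge0.
Qed.

Lemma stable_config (s : St lam) : stable lam (config_of_St s).
Proof. by apply/forallP => v; rewrite /unstable ffunE -leNgt lez_nat. Qed.

Lemma config_of_St_inj : injective (@config_of_St R N lam).
Proof.
move=> s t st; apply/ffunP => v; apply/val_inj/succn_inj.
by move/ffunP/(_ v) : st; rewrite !ffunE => -[/= ->].
Qed.

Lemma config_of_St_surj (eta : zvec N) :
  (forall v, 0 < eta v) -> stable lam eta -> exists s : St lam, eta = config_of_St s.
Proof.
move=> eta_gt0 /forallP st.
have lt_thr v : (`|eta v|.-1 < threshold lam v)%N.
  by have := st v; have := eta_gt0 v; rewrite /unstable -leNgt; case: (eta v) => -[].
exists [ffun v => Ordinal (lt_thr v)]; apply/ffunP => v; rewrite !ffunE/=.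
by have := eta_gt0 v; case: (eta v) => -[].
Qed.

Lemma sum_reach0 (eta : zvec N) (f : zvec N -> R) :
  (forall v, 0 < eta v) -> stable lam eta ->
  \sum_(s : St lam) reach 0 (config_of_St s) eta * f (config_of_St s) = f eta.
Proof.
move=> /config_of_St_surj surj /surj[t ->].
rewrite (bigD1 t)//= eqxx mul1r big1 ?addr0// => s s_neq_t.
by rewrite (inj_eq config_of_St_inj) eq_sym (negbTE s_neq_t) mul0r.
Qed.

Lemma reach_add_stable n sigma (xi chi : zvec N) :
  (forall v, 0 < xi v) -> stable lam xi ->
  reach n sigma (xi + chi) =
  \sum_(m < n.+1) \sum_(s : St lam)
    reach m (config_of_St s) xi * reach (n - m) sigma (config_of_St s + chi).
Proof.
move=> xi_gt0 xi_st; rewrite big_ord_recl subn0.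
rewrite (sum_reach0 (fun x => reach n sigma (x + chi)) xi_gt0 xi_st).
rewrite big1 ?addr0// => m _; rewrite big1// => s _.
by rewrite lift0 reachS_stable// mul0r.
Qed.

(** The first m topplings stabilize xi into s, ignoring chi; the remaining
    n - m stabilize s + chi. A site unstable in xi is also unstable in
    xi + chi, so by the abelian property both sides can be expanded by
    toppling the same site, which is the induction step. *)
Lemma reach_add n sigma (xi chi : zvec N) :
  stable lam sigma -> (forall v, 0 < xi v) -> (forall v, 0 <= chi v) ->
  reach n sigma (xi + chi) =
  \sum_(m < n.+1) \sum_(s : St lam)
    reach m (config_of_St s) xi * reach (n - m) sigma (config_of_St s + chi).
Proof.
move=> sigma_st xi_gt0 chi_ge0; elim: n xi xi_gt0 => [|n IHn] xi xi_gt0.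
all: have [xi_st|] := boolP (stable lam xi); first exact: reach_add_stable.
all: move=> /forallPn[v]; rewrite negbK => xi_v; rewrite big_ord_recl subn0.
all: have xichi_v : unstable lam (xi + chi) v
  by rewrite /unstable ffunE (lt_le_trans xi_v)// lerDl.
all: rewrite [X in _ = X + _]big1 ?add0r; last by
  move=> s _; rewrite (reach0_unstable (stable_config s) xi_v) mul0r.
  by rewrite big_ord0 (reach0_unstable sigma_st xichi_v).
rewrite (reach_topple _ sigma_st xichi_v).
under [RHS]eq_bigr => m _ do under eq_bigr => s _ do
  rewrite lift0 subSS (reach_topple _ (stable_config s) xi_v) mulr_suml.
under [RHS]eq_bigr do rewrite exchange_big.
rewrite exchange_big; apply: eq_big_seq => nu nu_supp.
rewrite addrAC IHn; last exact: topple_positive xi_v nu_supp.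
rewrite mulr_sumr; apply: eq_bigr => m _.
by rewrite mulr_sumr; apply: eq_bigr => s _; rewrite mulrA.
Qed.

End Sandpile.

(** * Runs and their stopping times *)

Local Open Scope classical_set_scope.

Section Run.
Variables (R : realType) (N : nat) (lam : 'I_N -> zlaw R N).
Variable pick : seq (zvec N) -> 'I_N.

(** Whether the run in state (cur, past) at time m stabilizes in exactly n
    further topplings, at sigma. Unlike [run], which is unfolded at its last
    step, this is unfolded at its first one, as required for conditioning on
    the next draw. *)
Fixpoint hits (Dw : nat -> 'I_N -> zvec N) (sigma : zvec N) (n m : nat)
    (cur : zvec N) (past : seq (zvec N)) : bool :=
  if n is n'.+1 then
    ~~ stable lam cur &&
    hits Dw sigma n' m.+1 (cur + Dw m (pick (cur :: past))) (cur :: past)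
  else cur == sigma.

Lemma hits_run Dw sigma eta n m :
  hits Dw sigma n m (run pick Dw eta m).1 (run pick Dw eta m).2 <->
  (forall j, (j < n)%N -> ~~ stable lam (run pick Dw eta (m + j)).1) /\
  (run pick Dw eta (m + n)).1 = sigma.
Proof.
(* An opaque X keeps the configurations from being unfolded below. *)
have [X XE] : exists X, forall j, (run pick Dw eta j).1 = X j by eexists.
under [in X in _ <-> X]eq_forall do rewrite XE.
rewrite [in X in _ <-> X]XE.
elim: n m => [|n IHn] m; first by rewrite XE addn0; split=> [/eqP|[_ /eqP]].
have := IHn m.+1; rewrite [hits _ _ n.+1 _ _ _]/= [run _ _ _ m.+1]/=.
have := XE m; case: (run pick Dw eta m) => [cur past]/= -> {}IHn.
split=> [/andP[Xm_unst /IHn[unst hit]]|[unst hit]].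
  rewrite -addSnnS; split=> // -[_|j j_lt]; first by rewrite addn0.
  by rewrite -addSnnS unst.
have := unst 0%N isT; rewrite addn0 => -> /=.
apply/IHn; rewrite addSnnS; split=> // j j_lt.
by rewrite addSnnS unst.
Qed.

Lemma hits_inj Dw sigma eta n n' : stable lam sigma ->
  hits Dw sigma n 0 eta [::] -> hits Dw sigma n' 0 eta [::] -> n = n'.
Proof.
move=> st /(hits_run _ _ _ _ 0)[unst hit] /(hits_run _ _ _ _ 0)[unst' hit'].
case: (ltngtP n n') => // [/unst'|/unst].
  by rewrite hit st.
by rewrite hit' st.
Qed.

Lemma RS_hits (Omega : Type) (D : nat -> 'I_N -> Omega -> zvec N) sigma eta w :
  stable lam sigma ->
  RS lam pick D eta w = Some sigma <->
  exists n, hits (fun m v => D m v w) sigma n 0 eta [::].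
Proof.
move=> st; set Dw := fun m v => D m v w.
have E n : hits Dw sigma n 0 eta [::] <->
  (forall j, (j < n)%N -> ~~ stable lam (run pick Dw eta j).1) /\
  (run pick Dw eta n).1 = sigma by exact: (hits_run Dw sigma eta n 0).
rewrite /RS -/Dw; case: pselect => [ex|nex]; last first.
  by split=> // -[n /E[_ hit]]; case: nex; exists n; rewrite hit.
case: ex_minnP => n stn minn; split=> [[hit]|[m /E[unst hit]]].
  by exists n; apply/E; split=> // j; rewrite ltnNge; apply: contra; exact: minn.
congr Some; rewrite -hit; congr (run _ _ _ _).1; apply/eqP.
by rewrite eqn_leq minn ?hit// leqNgt; apply: contraL stn => /unst.
Qed.

End Run.

(** * The law of the random stabilization *)

Section Law.
Variables (R : realType) (N : nat) (lam : 'I_N -> zlaw R N).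
Hypothesis lamP : forall v, toppling_law v (lam v).
Variables (d : measure_display) (Omega : measurableType d).
Variables (Pr : probability Omega R) (D : nat -> 'I_N -> Omega -> zvec N).
Hypothesis hD : independent_draws Pr lam D.
Variable pick : seq (zvec N) -> 'I_N.
Hypothesis hpick : legal_rule lam pick.

(** C plays the role of an event of the past at time m: for such C only
    independence from the draws at times >= m matters, and this property
    propagates along a run without describing C. *)
Definition indep_from (m : nat) (C : set Omega) : Prop :=
  measurable C /\
  forall (J : {fset nat * 'I_N}) (B : nat * 'I_N -> set (zvec N)),
    (forall j, j \in J -> (m <= j.1)%N) ->
    Pr (C `&` \bigcap_(j in [set` J]) (D j.1 j.2 @^-1` B j)) =
    (Pr C * \prod_(j <- J) Pr (D j.1 j.2 @^-1` B j))%E.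

Lemma indep_from0 : indep_from 0 setT.
Proof.
have [_ _ indep] := hD.
by split=> // J B _; rewrite setTI indep probability_setT mul1e.
Qed.

Lemma indep_from_draw m C v nu : indep_from m C ->
  Pr (C `&` D m v @^-1` [set nu]) = (Pr C * (lam v nu)%:E)%E.
Proof.
have [_ law _] := hD => -[_ /(_ [fset (m, v)]%fset (fun=> [set nu]))].
rewrite big_seq_fset1 set_fset1 bigcap_set1 law; apply.
by move=> j; rewrite inE => /eqP ->.
Qed.

Lemma indep_fromS m C v nu : indep_from m C ->
  indep_from m.+1 (C `&` D m v @^-1` [set nu]).
Proof.
have [mD law _] := hD => indepC; have [mC indep] := indepC.
split=> [|J B J_gt]; first exact: measurableI.
have mv_J : (m, v) \notin J by apply/negP => /J_gt; rewrite ltnn.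
pose B' j := if j == (m, v) then [set nu] else B j.
have B'E j : j \in J -> B' j = B j.
  by rewrite /B'; case: eqP => // -> /(negP mv_J).
have capE : \bigcap_(j in [set` J]) (D j.1 j.2 @^-1` B j) =
    \bigcap_(j in [set` J]) (D j.1 j.2 @^-1` B' j).
  by apply: eq_bigcapr => j /B'E ->.
have prodE : (\prod_(j <- J) Pr (D j.1 j.2 @^-1` B j) =
    \prod_(j <- J) Pr (D j.1 j.2 @^-1` B' j))%E.
  by apply: eq_big_seq => j /B'E ->.
have := indep ((m, v) |` J)%fset B'; rewrite big_fsetU1//= -prodE.
rewrite set_fsetU1 bigcap_setU1/= -capE /B' eqxx setIA law.
rewrite indep_from_draw// -muleA; apply.
by move=> j; rewrite !inE => /orP[/eqP -> //|/J_gt/ltnW].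
Qed.

Definition hitting (sigma : zvec N) n m cur past : set Omega :=
  [set w | hits lam pick (fun m v => D m v w) sigma n m cur past].

Lemma hitting0 sigma m cur past :
  hitting sigma 0 m cur past = if cur == sigma then setT else set0.
Proof. by rewrite /hitting/=; case: eqP => _; apply/seteqP; split=> w. Qed.

Lemma hittingS_stable sigma n m cur past :
  stable lam cur -> hitting sigma n.+1 m cur past = set0.
Proof. by move=> st; apply/seteqP; split=> // w; rewrite /hitting/= st. Qed.

Lemma hittingS sigma n m cur past : ~~ stable lam cur ->
  hitting sigma n.+1 m cur past = \bigcup_nu
    (D m (pick (cur :: past)) @^-1` [set nu] `&`
     hitting sigma n m.+1 (cur + nu) (cur :: past)).
Proof.
rewrite /hitting/= => ->; set v := pick _.
by apply/seteqP; split=> [w hit|w [nu _ [/= <-]]//]; exists (D m v w).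
Qed.

Lemma measurable_hitting sigma n m cur past :
  measurable (hitting sigma n m cur past).
Proof.
have [mD _ _] := hD.
elim: n m cur past => [|n IHn] m cur past.
  by rewrite hitting0; case: ifP => _; [exact: measurableT|exact: measurable0].
have [cur_st|cur_unst] := boolP (stable lam cur).
  by rewrite hittingS_stable//; exact: measurable0.
rewrite hittingS//; apply: countable_bigcupT_measurable => [|nu].
  exact: countableP.
exact: measurableI.
Qed.

Lemma hitting_draw sigma n m cur past nu : ~~ stable lam cur ->
  hitting sigma n.+1 m cur past `&` D m (pick (cur :: past)) @^-1` [set nu] =
  D m (pick (cur :: past)) @^-1` [set nu] `&`
    hitting sigma n m.+1 (cur + nu) (cur :: past).
Proof.
rewrite /hitting/= => ->.
by apply/seteqP; split=> w /= [] => [hit Dw|Dw hit]; rewrite -Dw in hit *.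
Qed.

(** Any legal rule has the same law as the one used in [reach]: the site v
    chosen from the history is unstable, so r_(n+1) = T_v r_n by the abelian
    property, while splitting along the value of the draw at v, which is
    independent of C, yields the same average T_v. *)
Lemma Pr_hitting sigma n m cur past C : stable lam sigma -> indep_from m C ->
  Pr (C `&` hitting sigma n m cur past) = (Pr C * (reach lam n sigma cur)%:E)%E.
Proof.
move=> sigma_st; have [mD law _] := hD.
elim: n m cur past C => [|n IHn] m cur past C indepC.
  rewrite hitting0/=; case: eqP => _; first by rewrite setIT mule1.
  by rewrite setI0 measure0 mule0.
have [cur_st|cur_unst] := boolP (stable lam cur).
  by rewrite hittingS_stable// setI0 measure0 reachS_stable// mule0.
set v := pick (cur :: past).
have cur_v : unstable lam cur v by exact: hpick.
have [_ _ lam1] := lamP v.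
have mCh : measurable (C `&` hitting sigma n.+1 m cur past).
  by apply: measurableI; [case: indepC|exact: measurable_hitting].
rewrite (reach_topple lamP _ sigma_st cur_v).
rewrite (measure_split_fin (X := D m v) (F := finsupp (lam v)) mCh)//; last first.
  by under eq_bigr do rewrite law; rewrite sumEFin lam1.
under eq_bigr => nu _.
  rewrite -setIA hitting_draw// -/v setIA IHn; last exact: indep_fromS.
  rewrite indep_from_draw// -muleA -EFinM; over.
rewrite -ge0_sume_distrr; first by rewrite sumEFin.
move=> nu _; rewrite lee_fin mulr_ge0 ?reach_ge0//.
by have [_ ->] := lamP v.
Qed.

Lemma RS_bigcup sigma eta : stable lam sigma ->
  [set w | RS lam pick D eta w = Some sigma] =
  \bigcup_n hitting sigma n 0 eta [::].
Proof.
move=> st; apply/seteqP; split=> [w /(RS_hits pick D eta w st)[n hit]|w [n _ hit]].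
  by exists n.
by apply/(RS_hits pick D eta w st); exists n.
Qed.

Lemma Pr_RS sigma eta : stable lam sigma ->
  Pr [set w | RS lam pick D eta w = Some sigma] =
  (\sum_(n <oo) (reach lam n sigma eta)%:E)%E.
Proof.
move=> st; rewrite RS_bigcup//  measure_semi_bigcup.
- apply: eq_eseriesr => n _.
  have := Pr_hitting n eta [::] st indep_from0.
  by rewrite setTI probability_setT mul1e.
- by move=> n; exact: measurable_hitting.
- by move=> n n' _ _ [w [hit hit']]; exact: hits_inj hit hit'.
- by apply: bigcupT_measurable => n; exact: measurable_hitting.
Qed.

(** * Products of the transition matrices *)

Lemma reach_series_fin_num sigma eta : stable lam sigma ->
  (\sum_(n <oo) (reach lam n sigma eta)%:E)%E \is a fin_num.
Proof.
move=> sigma_st; rewrite -Pr_RS// fin_num_measure// RS_bigcup//.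
by apply: bigcupT_measurable => n; exact: measurable_hitting.
Qed.

Lemma PmxE k i j : ((Pmx Pr lam pick D k i j)%:E =
  \sum_(n <oo) (reach lam n (config_of_St (enum_val j))
                            (config_of_St (enum_val i) + delta k))%:E)%E.
Proof.
have st := stable_config (enum_val j).
by rewrite mxE Pr_RS// fineK// reach_series_fin_num.
Qed.

Lemma Pmx_mulE k l i j :
  (((Pmx Pr lam pick D k *m Pmx Pr lam pick D l) i j)%:E =
  \sum_(n <oo) (reach lam n (config_of_St (enum_val j))
                 (config_of_St (enum_val i) + delta k + delta l))%:E)%E.
Proof.
set xi := config_of_St (enum_val i) + delta k; set sigma := config_of_St _.
have sigma_st : stable lam sigma by exact: stable_config.
have delta_ge0 (q v : 'I_N) : 0 <= delta q v by rewrite ffunE.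
have xi_gt0 v : 0 < xi v by rewrite ffunE ltr_pwDl// ffunE.
have reach_sum n : reach lam n sigma (xi + delta l) =
    \sum_(q < #|{: St lam}|)
      \sum_(m < n.+1) reach lam m (config_of_St (enum_val q)) xi *
      reach lam (n - m) sigma (config_of_St (enum_val q) + delta l).
  rewrite (reach_add lamP)// exchange_big (reindex (fun q : 'I_#|{: St lam}| => enum_val q))//.
exact/onW_bij/enum_val_bij.
under [RHS]eq_eseriesr do rewrite reach_sum -sumEFin.
rewrite nneseries_sum; last first.
  move=> q n _; rewrite lee_fin sumr_ge0// => m _.
  by rewrite mulr_ge0// reach_ge0.
rewrite mxE -sumEFin; apply: eq_bigr => q _.
rewrite EFinM !PmxE -nneseries_cauchy_product//.
- by move=> n; exact: reach_ge0.
- by move=> n; exact: reach_ge0.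
- exact: reach_series_fin_num.
Qed.

End Law.

Local Close Scope classical_set_scope.

Theorem proposition11 (R : realType) (N : nat) (lam : 'I_N -> zlaw R N)
    (hlam : forall v, toppling_law v (lam v)) (hdiss : dissipative lam)
    (d : measure_display) (Omega : measurableType d)
    (Pr : probability Omega R)
    (D : nat -> 'I_N -> Omega -> zvec N)
    (hD : independent_draws Pr lam D)
    (pick : seq (zvec N) -> 'I_N) (hpick : legal_rule lam pick)
    (k l : 'I_N) :
  Pmx Pr lam pick D k *m Pmx Pr lam pick D l =
  Pmx Pr lam pick D l *m Pmx Pr lam pick D k.
Proof.
apply/matrixP => i j; apply: EFin_inj.
by rewrite !(Pmx_mulE hlam hD hpick) addrAC.
Qed.
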